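(* Let $c\ge1$. A Leibniz algebra $\mathfrak q$ is $c$-$\mathsf{Lie}$-capable if and only if, for every non-zero element $x\in\mathcal Z_c^{\mathsf{Lie}}(\mathfrak q)$, the natural map $\mathcal M_{\mathsf{Lie}}^{(c)}(\mathfrak q)\to\mathcal M_{\mathsf{Lie}}^{(c)}(\mathfrak q/\langle x\rangle)$ has non-trivial kernel.
   Context: $\mathbb K$ is a field with $\frac12\in\mathbb K$. A Leibniz algebra is a $\mathbb K$-vector space with a bilinear bracket satisfying $[x,[y,z]]=[[x,y],z]-[[x,z],y]$. $\langle x\rangle$ denotes the two-sided ideal of $\mathfrak q$ generated by $x$. For two-sided ideals $\mathfrak m,\mathfrak n$ of $\mathfrak q$, $[\mathfrak m,\mathfrak n]_{\mathsf{Lie}}$ is the span of all $[m,n]+[n,m]$, $m\in\mathfrak m$, $n\in\mathfrak n$. For a two-sided ideal $\mathfrak n$: $\gamma_1^{\mathsf{Lie}}(\mathfrak q,\mathfrak n)=\mathfrak n$, $\gamma_i^{\mathsf{Lie}}(\mathfrak q,\mathfrak n)=[\gamma_{i-1}^{\mathsf{Lie}}(\mathfrak q,\mathfrak n),\mathfrak q]_{\mathsf{Lie}}$ for $i\ge2$, and $\gamma_i^{\mathsf{Lie}}(\mathfrak q)=\gamma_i^{\mathsf{Lie}}(\mathfrak q,\mathfrak q)$. $\mathcal Z_0^{\mathsf{Lie}}(\mathfrak h)=0$, $\mathcal Z_i^{\mathsf{Lie}}(\mathfrak h)=\{y\in\mathfrak h:[y,h]+[h,y]\in\mathcal Z_{i-1}^{\mathsf{Lie}}(\mathfrak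 h)\ \forall h\in\mathfrak h\}$. $\mathfrak q$ is $c$-$\mathsf{Lie}$-capable if $\mathfrak q\cong\mathfrak h/\mathcal Z_c^{\mathsf{Lie}}(\mathfrak h)$ for some Leibniz algebra $\mathfrak h$. Given a free presentation $0\to\mathfrak r\to\mathfrak f\xrightarrow{\rho}\mathfrak q\to0$ ($\mathfrak f$ a free Leibniz algebra), a two-sided ideal $\mathfrak n$ of $\mathfrak q$ and $\mathfrak s=\rho^{-1}(\mathfrak n)$: $\mathcal M_{\mathsf{Lie}}^{(c)}(\mathfrak q)=(\mathfrak r\cap\gamma_{c+1}^{\mathsf{Lie}}(\mathfrak f))/\gamma_{c+1}^{\mathsf{Lie}}(\mathfrak f,\mathfrak r)$, $\mathcal M_{\mathsf{Lie}}^{(c)}(\mathfrak q/\mathfrak n)=(\mathfrak s\cap\gamma_{c+1}^{\mathsf{Lie}}(\mathfrak f))/\gamma_{c+1}^{\mathsf{Lie}}(\mathfrak f,\mathfrak s)$, and the natural map is induced by $\mathfrak r\subseteq\mathfrak s$. *)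

(* Defs.v *)
From HB Require Import structures.
From mathcomp Require Export all_boot all_order all_algebra.
From mathcomp Require Export ring_quotient boolp classical_sets.
Set Implicit Arguments.
Unset Strict Implicit.
Unset Printing Implicit Defensive.
Import GRing.Theory.
Local Open Scope classical_set_scope.
Local Open Scope quotient_scope.
Local Open Scope ring_scope.

HB.mixin Record isLeibniz (K : fieldType) V of GRing.Lmodule K V := {
  br : V -> V -> V;
  br_linearl : forall y : V, linear (br ^~ y);
  br_linearr : forall x : V, linear (br x);
  br_leibniz : forall x y z : V,
    br x (br y z) = br (br x y) z - br (br x z) y
}.

#[short(type="leibnizType")]
HB.structure Definition Leibniz (K : fieldType) :=
  {V of isLeibniz K V & GRing.Lmodule K V}.

Section Bracket.
Context {K : fieldType} {q : leibnizType K}.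
Implicit Types x y z : q.

Lemma brDl x x' y : br (x + x') y = br x y + br x' y.
Proof. by have := br_linearl y 1 x x'; rewrite /= !scale1r. Qed.

Lemma brDr x y y' : br x (y + y') = br x y + br x y'.
Proof. by have := br_linearr x 1 y y'; rewrite !scale1r. Qed.

Lemma br0l y : br 0 y = 0.
Proof. by apply: (addrI (br 0 y)); rewrite -brDl !addr0. Qed.

Lemma br0r x : br x 0 = 0.
Proof. by apply: (addrI (br x 0)); rewrite -brDr !addr0. Qed.

Lemma brZl a x y : br (a *: x) y = a *: br x y.
Proof. by have := br_linearl y a x 0; rewrite /= br0l !addr0. Qed.

Lemma brZr a x y : br x (a *: y) = a *: br x y.
Proof. by have := br_linearr x a y 0; rewrite br0r !addr0. Qed.

Lemma brNl x y : br (- x) y = - br x y.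
Proof. by rewrite -scaleN1r brZl scaleN1r. Qed.

Lemma brNr x y : br x (- y) = - br x y.
Proof. by rewrite -scaleN1r brZr scaleN1r. Qed.

End Bracket.

Definition leibniz_morphism (K : fieldType) (p q : leibnizType K)
    (g : {linear p -> q}) : Prop :=
  forall x y, g (br x y) = br (g x) (g y).

Definition leibniz_iso (K : fieldType) (p q : leibnizType K) : Prop :=
  exists g : {linear p -> q}, leibniz_morphism g /\ bijective g.

Definition free_leibniz (K : fieldType) (f : leibnizType K) : Prop :=
  exists (X : Type) (i : X -> f), forall (h : leibnizType K) (g : X -> h),
    (exists phi : {linear f -> h}, leibniz_morphism phi /\ phi \o i =1 g) /\
    (forall phi psi : {linear f -> h},
       leibniz_morphism phi -> leibniz_morphism psi ->
       phi \o i =1 g -> psi \o i =1 g -> phi =1 psi).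

Definition free_presentation (K : fieldType) (q f : leibnizType K)
    (rho : {linear f -> q}) : Prop :=
  [/\ free_leibniz f, leibniz_morphism rho & forall y, exists x, rho x = y].

Definition subspace (K : fieldType) (V : lmodType K) (A : set V) : Prop :=
  A 0 /\ forall (a : K) u v, A u -> A v -> A (a *: u + v).

Definition ideal (K : fieldType) (q : leibnizType K) (A : set q) : Prop :=
  subspace A /\ forall x y, A x -> A (br x y) /\ A (br y x).

Definition lspan (K : fieldType) (V : lmodType K) (A : set V) : set V :=
  smallest (@subspace K V) A.

Definition ideal_gen (K : fieldType) (q : leibnizType K) (x : q) : set q :=
  smallest (@ideal K q) [set x].

Section Subspaces.
Context {K : fieldType} {V : lmodType K}.
Implicit Types A B : set V.

Lemma subspaceD A u v : subspace A -> A u -> A v -> A (u + v).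
Proof. by move=> [_ h] Au Av; have := h 1 _ _ Au Av; rewrite scale1r. Qed.

Lemma subspaceZ A a u : subspace A -> A u -> A (a *: u).
Proof. by move=> [h0 h] Au; have := h a _ _ Au h0; rewrite addr0. Qed.

Lemma subspaceN A u : subspace A -> A u -> A (- u).
Proof. by move=> h Au; rewrite -scaleN1r; apply: subspaceZ. Qed.

Lemma subspaceT : subspace [set: V]. Proof. by []. Qed.

Lemma subspace0 : subspace [set 0 : V].
Proof. by split=> // a u v /= -> ->; rewrite scaler0 addr0. Qed.

Lemma subspaceI A B : subspace A -> subspace B -> subspace (A `&` B).
Proof.
move=> [A0 hA] [B0 hB]; split=> // a u v [Au Bu] [Av Bv].
by split; [apply: hA | apply: hB].
Qed.

Lemma lspan_subspace A : subspace (lspan A).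
Proof.
split=> [B [[B0 _] _] //| a u v hu hv B hB].
case: (hB) => -[_ h] _; exact: (h a u v (hu B hB) (hv B hB)).
Qed.

Lemma preim_subspace {W : lmodType K} (g : {linear W -> V}) A :
  subspace A -> subspace (g @^-1` A).
Proof.
move=> [A0 hA]; split=> [|a u v /= Au Av]; first by rewrite /= linear0.
by rewrite linearP; apply: hA.
Qed.

End Subspaces.

Lemma ideal_gen_ideal (K : fieldType) (q : leibnizType K) (x : q) :
  ideal (ideal_gen x).
Proof.
split; first split.
- by move=> B [[[B0 _] _] _].
- move=> a u v hu hv B hB.
  case: (hB) => -[[_ h] _] _; exact: (h a u v (hu B hB) (hv B hB)).
- move=> u v hu; split=> B hB; case: (hB) => -[_ h] _.
  exact: (proj1 (h u v (hu B hB))).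
  exact: (proj2 (h u v (hu B hB))).
Qed.

(** A subspace as a [submodClosed] predicate, so that the library's subtype and
    quotient constructions apply to it. *)
Definition subspace_pred (K : fieldType) (V : lmodType K) (A : set V)
  (hA : subspace A) : {pred V} := fun v => v \in A.

Section SubspaceType.
Context {K : fieldType} {V : lmodType K} {A : set V} (hA : subspace A).

Fact subspace_pred_closed : submod_closed (subspace_pred hA).
Proof.
split; first by rewrite unfold_in inE; case: hA.
by move=> a u v; rewrite !unfold_in !inE; case: hA => _; apply.
Qed.

HB.instance Definition _ :=
  GRing.isSubmodClosed.Build K V (subspace_pred hA) subspace_pred_closed.

Definition subspace_type : Type := {v : V | v \in subspace_pred hA}.
HB.instance Definition _ := SubChoice.on subspace_type.
HB.instance Definition _ :=
  [SubChoice_isSubLmodule of subspace_type by <:].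

Definition lquot : Type := {ideal_quot subspace_pred hA}.
HB.instance Definition _ := GRing.Zmodule.on lquot.

Definition lpi (v : V) : lquot := \pi_({ideal_quot subspace_pred hA}) v.
Definition lrepr (u : lquot) : V := repr (u : {ideal_quot subspace_pred hA}).

Lemma lreprK u : lpi (lrepr u) = u. Proof. exact: reprK. Qed.

Lemma lpi_eq u v : lpi u = lpi v <-> A (u - v).
Proof.
have e := Quotient.idealrBE (subspace_pred hA) u v.
by split=> [/eqP h|h]; [apply: set_mem | apply/eqP]; move: e;
  rewrite unfold_in; [move=> ->|move=> <-; apply: mem_set].
Qed.

Lemma lpiD u v : lpi (u + v) = lpi u + lpi v.
Proof. by rewrite /lpi !piE. Qed.

Definition lquot_scale (a : K) (u : lquot) : lquot := lpi (a *: lrepr u).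

Lemma lrepr_pi v : A (lrepr (lpi v) - v).
Proof. by apply/lpi_eq; rewrite lreprK. Qed.

Lemma lpiZ a v : lpi (a *: v) = lquot_scale a (lpi v).
Proof.
apply/esym/lpi_eq; rewrite -scalerBr; apply: subspaceZ hA _; exact: lrepr_pi.
Qed.

Fact lquot_scaleA a b u :
  lquot_scale a (lquot_scale b u) = lquot_scale (a * b) u.
Proof. by rewrite -[u]lreprK -!lpiZ scalerA. Qed.
Fact lquot_scale1 : left_id 1 lquot_scale.
Proof. by move=> u; rewrite -[u]lreprK -lpiZ scale1r. Qed.
Fact lquot_scaleDr : right_distributive lquot_scale +%R.
Proof.
by move=> a u v; rewrite -[u]lreprK -[v]lreprK -!lpiZ -!lpiD -lpiZ scalerDr.
Qed.
Fact lquot_scaleDl u : {morph lquot_scale^~ u : a b / a + b}.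
Proof. by move=> a b /=; rewrite -[u]lreprK -!lpiZ -!lpiD scalerDl. Qed.

HB.instance Definition _ := GRing.Zmodule_isLmodule.Build K lquot
  lquot_scaleA lquot_scale1 lquot_scaleDr lquot_scaleDl.

Fact lpi_linear : linear lpi.
Proof. by move=> a u v; rewrite lpiD lpiZ. Qed.
HB.instance Definition _ := GRing.isLinear.Build K V lquot _ lpi lpi_linear.

End SubspaceType.

Section LeibnizQuotient.
Context {K : fieldType} {q : leibnizType K} {I : set q} (hI : ideal I).

Definition leibniz_quot : Type := lquot (proj1 hI).
HB.instance Definition _ := GRing.Lmodule.on leibniz_quot.

Definition qpi : q -> leibniz_quot := lpi (proj1 hI).
HB.instance Definition _ := GRing.Linear.on qpi.

Lemma qreprK u : qpi (lrepr u) = u. Proof. exact: lreprK. Qed.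

Definition quot_br (u v : leibniz_quot) : leibniz_quot :=
  qpi (br (lrepr u) (lrepr v)).

Lemma qpi_br x y : qpi (br x y) = quot_br (qpi x) (qpi y).
Proof.
apply/esym/lpi_eq; set x' := lrepr _; set y' := lrepr _.
have hx : I (x' - x) by exact: lrepr_pi.
have hy : I (y' - y) by exact: lrepr_pi.
have -> : br x' y' - br x y = br (x' - x) y' + br x (y' - y).
  by rewrite brDl brDr brNl brNr addrA subrK.
apply: subspaceD (proj1 hI) _ _.
  exact: (proj1 (proj2 hI _ y' hx)).
exact: (proj2 (proj2 hI _ x hy)).
Qed.

Fact quot_br_linearl v : linear (quot_br ^~ v).
Proof.
move=> a u u' /=; rewrite -[u]qreprK -[u']qreprK -[v]qreprK.
by rewrite -linearP -!qpi_br -linearP br_linearl.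
Qed.

Fact quot_br_linearr u : linear (quot_br u).
Proof.
move=> a v v'; rewrite -[u]qreprK -[v]qreprK -[v']qreprK.
by rewrite -linearP -!qpi_br -linearP br_linearr.
Qed.

Fact quot_br_leibniz u v w :
  quot_br u (quot_br v w) = quot_br (quot_br u v) w - quot_br (quot_br u w) v.
Proof.
rewrite -[u]qreprK -[v]qreprK -[w]qreprK.
by rewrite -!qpi_br -linearB br_leibniz.
Qed.

HB.instance Definition _ := isLeibniz.Build K leibniz_quot
  quot_br_linearl quot_br_linearr quot_br_leibniz.

End LeibnizQuotient.

Section LieSeries.
Context {K : fieldType} {q : leibnizType K}.
Implicit Types (m n : set q) (x y z : q).

Definition lie_comm m n : set q :=
  lspan [set z | exists x y, [/\ m x, n y & z = br x y + br y x]].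

(** The series starts at index 1: [gamma_lie n 1 = n]; index 0 is not used. *)
Definition gamma_lie n (i : nat) : set q :=
  iter i.-1 (fun m => lie_comm m [set: q]) n.

Fixpoint Z_lie (i : nat) : set q :=
  if i is j.+1 then [set y | forall x, Z_lie j (br y x + br x y)]
  else [set 0].

Lemma gamma_lie_subspace n i : subspace n -> subspace (gamma_lie n i).
Proof.
by rewrite /gamma_lie; case: i.-1 => [|j] // _; apply: lspan_subspace.
Qed.

Lemma br_sym x y z : br x (br y z + br z y) = 0.
Proof. by rewrite brDr !br_leibniz addrA subrK subrr. Qed.

Lemma Z_lie_ideal i : ideal (Z_lie i).
Proof.
suff [] : ideal (Z_lie i) /\ Z_lie i `<=` Z_lie i.+1 by [].
elim: i => [|i [[sZ iZ] leZ]].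
  have id0 : ideal (Z_lie 0).
    split; first exact: subspace0.
    by move=> x y /= ->; rewrite br0l br0r.
  by split=> // x /= -> y; rewrite br0l br0r addr0.
have sZ' : subspace (Z_lie i.+1).
  split=> [y|a u v hu hv y] /=.
    by rewrite br0l br0r addr0; case: sZ.
  rewrite brDl brDr brZl brZr addrACA -scalerDr.
  by case: sZ => _; apply; [apply: hu | apply: hv].
have idZ : ideal (Z_lie i.+1).
  split=> // y k hy.
  have hyk : Z_lie i.+1 (br y k).
    move=> x.
    have -> : br (br y k) x + br x (br y k) =
        br (br y x + br x y) k - (br y (br x k) + br (br x k) y).
      have -> : br (br y k) x = br y (br k x) + br (br y x) k.
        by rewrite br_leibniz subrK.
      have -> : br y (br x k) = - br y (br k x).
        by apply/eqP; rewrite -subr_eq0 opprK -brDr br_sym.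
      rewrite [br x (br y k)]br_leibniz brDl opprD opprK.
      by rewrite [_ + br (br y x) k]addrC addrACA.
    apply: subspaceD (sZ) _ _; first exact: (proj1 (iZ _ k (hy x))).
    by apply: subspaceN => //; exact: (hy (br x k)).
  split=> //.
  have -> : br k y = (br y k + br k y) - br y k by rewrite addrC addKr.
  apply: subspaceD (sZ') _ _; last exact: subspaceN sZ' hyk.
  by apply: leZ; exact: (hy k).
split=> // y hy x; case: (proj2 idZ y x hy) => hyx hxy.
exact: subspaceD (sZ') hyx hxy.
Qed.

End LieSeries.

Arguments Z_lie {K} q i.
Arguments Z_lie_ideal {K} q i.

Definition lie_capable (K : fieldType) (c : nat) (q : leibnizType K) : Prop :=
  exists h : leibnizType K, leibniz_iso q (leibniz_quot (Z_lie_ideal h c)).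

Section Multiplier.
Context {K : fieldType} {f : leibnizType K} (c : nat).
Implicit Types r s : set f.

Definition mult_num r : set f := r `&` gamma_lie [set: f] c.+1.

Lemma mult_num_subspace r : subspace r -> subspace (mult_num r).
Proof.
by move=> hr; apply: subspaceI => //; apply: gamma_lie_subspace subspaceT.
Qed.

Section Def.
Context {r : set f} (hr : subspace r).

Definition mult_num_type : Type := subspace_type (mult_num_subspace hr).
HB.instance Definition _ := GRing.Lmodule.on mult_num_type.

Definition mult_incl (u : mult_num_type) : f :=
  val (u : subspace_type (mult_num_subspace hr)).

Fact mult_incl_linear : linear mult_incl.
Proof. by []. Qed.
HB.instance Definition _ :=
  GRing.isLinear.Build K mult_num_type f _ mult_incl mult_incl_linear.

Lemma mult_inclP u : mult_num r (mult_incl u).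
Proof. by have := valP u; rewrite unfold_in inE. Qed.

(** The denominator [gamma_{c+1}(f, r)] as a subspace of the numerator. When [r]
    is a two-sided ideal it is contained in the numerator ([gamma_lie_sub_num]
    below), so pulling it back along the inclusion loses nothing. *)
Definition mult_den : set mult_num_type :=
  mult_incl @^-1` gamma_lie r c.+1.

Definition mult_den_subspace : subspace mult_den :=
  preim_subspace mult_incl (gamma_lie_subspace c.+1 hr).

(** [(r `&` gamma_{c+1}(f)) / gamma_{c+1}(f, r)] *)
Definition lie_multiplier : Type := lquot mult_den_subspace.
HB.instance Definition _ := GRing.Lmodule.on lie_multiplier.

Definition mult_pi : mult_num_type -> lie_multiplier := lpi mult_den_subspace.
HB.instance Definition _ := GRing.Linear.on mult_pi.

End Def.

Arguments mult_pi {r} hr u.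

Lemma lspan_le {V : lmodType K} (A B : set V) :
  A `<=` B -> lspan A `<=` lspan B.
Proof. by move=> AB; apply: sub_smallest2r AB; apply: lspan_subspace. Qed.

Lemma gamma_lie_le r s i : r `<=` s -> gamma_lie r i `<=` gamma_lie s i.
Proof.
move=> rs; rewrite /gamma_lie; elim: i.-1 => [|j IH] //=.
by apply: lspan_le => z [x [y [hx hy ->]]]; exists x, y; split=> //; apply: IH.
Qed.

Lemma gamma_lie_sub_num r : ideal r -> gamma_lie r c.+1 `<=` mult_num r.
Proof.
move=> hr x hx; split; last exact: gamma_lie_le (@subsetT _ r) _ hx.
move: x hx; rewrite /gamma_lie /=; elim: c => [|j IH] //=.
apply: smallest_sub; first exact: (proj1 hr).
move=> z [x [y [/IH hx _ ->]]]; case: (proj2 hr x y hx) => hxy hyx.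
exact: subspaceD (proj1 hr) hxy hyx.
Qed.

Section Map.
Context {r s : set f} (hr : subspace r) (hs : subspace s) (hrs : r `<=` s).

Lemma mult_num_map_subproof (u : mult_num_type hr) :
  mult_incl u \in subspace_pred (mult_num_subspace hs).
Proof.
rewrite unfold_in inE; case: (mult_inclP u) => hu hu'.
by split=> //; apply: hrs.
Qed.

Definition mult_num_map (u : mult_num_type hr) : mult_num_type hs :=
  exist _ (mult_incl u) (mult_num_map_subproof u).

Definition mult_map (u : lie_multiplier hr) : lie_multiplier hs :=
  mult_pi hs (mult_num_map (lrepr u)).

Lemma mult_map_pi u : mult_map (mult_pi hr u) = mult_pi hs (mult_num_map u).
Proof.
apply/lpi_eq; apply: gamma_lie_le hrs _ _.
exact: (lrepr_pi (mult_den_subspace hr) u).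
Qed.

Fact mult_map_linear : linear mult_map.
Proof.
move=> a u v; rewrite -[u]lreprK -[v]lreprK.
rewrite -[lpi _ (lrepr u)]/(mult_pi hr _) -[lpi _ (lrepr v)]/(mult_pi hr _).
rewrite -linearP !mult_map_pi -linearP; congr (mult_pi hs _).
exact: val_inj.
Qed.
HB.instance Definition _ := GRing.isLinear.Build K
  (lie_multiplier hr) (lie_multiplier hs) _ mult_map mult_map_linear.

End Map.

Arguments mult_map {r s} hr hs hrs u.

End Multiplier.

Arguments mult_pi {K f c r} hr u.
Arguments mult_map {K f c r s} hr hs hrs u.

Section Presentation.
Context {K : fieldType} {q f : leibnizType K} (c : nat) (rho : {linear f -> q}).

Lemma ker_subspace : subspace (rho @^-1` [set 0]).
Proof. exact: preim_subspace subspace0. Qed.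

Lemma preim_gen_subspace (x : q) : subspace (rho @^-1` ideal_gen x).
Proof. exact: preim_subspace (proj1 (ideal_gen_ideal x)). Qed.

Lemma ker_sub_preim_gen (x : q) : rho @^-1` [set 0] `<=` rho @^-1` ideal_gen x.
Proof. by move=> y /= ->; case: (ideal_gen_ideal x) => -[]. Qed.

Definition M_lie : Type := lie_multiplier c ker_subspace.
HB.instance Definition _ := GRing.Lmodule.on M_lie.

(** The multiplier of [q / <x>], computed from the free presentation
    [f -> q -> q / <x>], whose kernel is [rho @^-1` <x>]. *)
Definition M_lie_quot (x : q) : Type := lie_multiplier c (preim_gen_subspace x).
HB.instance Definition _ x := GRing.Lmodule.on (M_lie_quot x).

(** The map induced by [ker rho `<=` rho @^-1` <x>]. *)
Definition M_lie_map (x : q) : M_lie -> M_lie_quot x :=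
  mult_map ker_subspace (preim_gen_subspace x) (@ker_sub_preim_gen x).
HB.instance Definition _ x := GRing.Linear.on (M_lie_map x).

End Presentation.

Arguments M_lie_map {K q f} c rho x u.

(* Main.v *)
(** Write x ∘ y = [x, y] + [y, x] and let r = ker rho. If the kernels are all
    non-trivial, then the largest A with A ∘ f ∘ ... ∘ f (c factors f) inside
    g = gamma_{c+1}(f, r) is r itself, and q = (f / g) / Z_c(f / g).

    Conversely let q = h / Z_c(h) and lift rho to phi : f -> h. For c > 1,
    h = phi(f) + Z_c(h) does not by itself allow replacing h by phi(f) in
    phi(a) ∘ h ∘ ... ∘ h, because (h ∘ h) ∘ Z_c(h) need not lie in Z_{c-2}(h).
    Freeness of f repairs this: x ∘ y is killed by left brackets, so f acts on
    f ∘ f by right brackets only, and f is a free right module. Hence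
    J' ∘ f <= J ∘ f implies J' <= J for ideals J', J of f inside f ∘ f, and
    gamma_{c+1}(f, s) <= gamma_{c+1}(f, r) already forces s ∘ f <= r ∘ f. Then a
    in s has phi(a) ∘ h <= Z_{c-1}(h), that is rho(a) = 0. *)
From HB Require Import structures.
Require Import Defs.
From mathcomp Require Import functions.
Set Implicit Arguments.
Unset Strict Implicit.
Unset Printing Implicit Defensive.
Import GRing.Theory.
Local Open Scope classical_set_scope.
Local Open Scope ring_scope.

(** * The extension behind Fox derivatives *)

Section FoxExtension.
Context {K : fieldType} {N : leibnizType K}.

Fact linear_subspace : subspace [set E : N -> N | linear E].
Proof.
split=> [a u v /=|a E F linE linF b u v /=].
  by rewrite scaler0 addr0.
by rewrite !addrfctE !scalrfctE linE linF !scalerDr !scalerA [a * b]mulrC addrACA.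
Qed.

Definition lendo : Type := subspace_type linear_subspace.
HB.instance Definition _ := GRing.Lmodule.on lendo.

Definition lendo_fun (E : lendo) : N -> N :=
  val (E : subspace_type linear_subspace).

Fact lendo_fun_linear E : linear (lendo_fun E).
Proof. by have := valP E; rewrite unfold_in inE. Qed.
HB.instance Definition _ E :=
  GRing.isLinear.Build K N N _ (lendo_fun E) (lendo_fun_linear E).

Lemma lendo_ext (E F : lendo) : lendo_fun E =1 lendo_fun F -> E = F.
Proof. by move=> EF; apply: val_inj; apply/funext. Qed.

Lemma lendo_funP a (E F : lendo) n :
  lendo_fun (a *: E + F) n = a *: lendo_fun E n + lendo_fun F n.
Proof. by []. Qed.

Lemma lendo_funB (E F : lendo) n :
  lendo_fun (E - F) n = lendo_fun E n - lendo_fun F n.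
Proof. by []. Qed.

Fact lendo_mk_subproof (g : N -> N) (g_lin : linear g) :
  g \in subspace_pred linear_subspace.
Proof. by rewrite unfold_in inE. Qed.

Definition lendo_mk (g : N -> N) (g_lin : linear g) : lendo :=
  exist _ g (lendo_mk_subproof g_lin).

Lemma lendo_mkE (g : N -> N) (g_lin : linear g) n :
  lendo_fun (lendo_mk g_lin) n = g n.
Proof. by []. Qed.

(** The formula is the second component of the commutator of the operators
    [(n, k) |-> (br n b, E n)] and [(n, k) |-> (br n b', E' n)]. *)
Fact fox_op_linear (b b' : N) (E E' : lendo) :
  linear (fun n => lendo_fun E' (br n b) - lendo_fun E (br n b')).
Proof.
move=> a u v; rewrite !brDl !brZl !linearP /= scalerDr; exact: addrACA.
Qed.

(** [(b, E, m)] stands for the vector [(b, m)] of [N * N] together with the right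
    operator [(n, k) |-> (br n b, E n)] on [N * N]; the bracket applies the
    operator of the second argument to the vector of the first, and takes the
    commutator of the operators. *)
Definition fox_ext : Type := (N * lendo * N)%type.
HB.instance Definition _ := GRing.Lmodule.on fox_ext.

Definition fox_br (x y : fox_ext) : fox_ext :=
  (br x.1.1 y.1.1, lendo_mk (fox_op_linear x.1.1 y.1.1 x.1.2 y.1.2),
   lendo_fun y.1.2 x.1.1).

Lemma fox_eq (x y : fox_ext) : x.1.1 = y.1.1 ->
  lendo_fun x.1.2 =1 lendo_fun y.1.2 -> x.2 = y.2 -> x = y.
Proof.
by case: x => [[b E] m]; case: y => [[b' E'] m'] /= -> /lendo_ext -> ->.
Qed.

Fact fox_br_linearl y : linear (fox_br ^~ y).
Proof.
move=> a x x'; apply: fox_eq => [|n|] /=.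
- by rewrite brDl brZl.
- rewrite lendo_funP !lendo_mkE brDr brZr lendo_funP linearP scalerBr opprD.
  exact: addrACA.
- exact: linearP.
Qed.

Fact fox_br_linearr x : linear (fox_br x).
Proof.
move=> a y y'; apply: fox_eq => [|n|] /=.
- by rewrite brDr brZr.
- rewrite lendo_funP !lendo_mkE brDr brZr lendo_funP linearP scalerBr opprD.
  exact: addrACA.
- by [].
Qed.

Fact fox_br_leibniz x y z :
  fox_br x (fox_br y z) = fox_br (fox_br x y) z - fox_br (fox_br x z) y.
Proof.
apply: fox_eq => [|n|] /=.
- exact: br_leibniz.
- rewrite lendo_funB !lendo_mkE !br_leibniz !linearB /=.
  rewrite !opprK !addrA [RHS](ACl (1*5*8*4*(3*6)*(2*7))).
  by rewrite /= !addNr !addr0.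
- by [].
Qed.

HB.instance Definition _ := isLeibniz.Build K fox_ext
  fox_br_linearl fox_br_linearr fox_br_leibniz.

End FoxExtension.

(** [D] undoes the right multiplication by a generator [x]. The value [x = 0]
    covers the free algebra on no generators. *)
Lemma fox_derivative (K : fieldType) (f N : leibnizType K)
    (p : {linear f -> N}) : free_leibniz f -> leibniz_morphism p ->
  exists (x : f) (D : {linear f -> N}) (E : f -> N -> N),
    [/\ E x =1 id, forall b, E b 0 = 0 &
        forall w b, D (br w b) = E b (p w)].
Proof.
move=> [X [i univ]] p_morph.
have [[t _]|X0] := pselect (exists t : X, True); last first.
  exists 0, \0, (fun _ n => n); split=> // w b.
  (* Without generators the identity and zero agree on all generators, so [f] is zero. *)
  have eq0 := (univ f i).2 idfun \0.
  have -> : w = 0.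
    apply: eq0 => // [y z|t] /=; first by rewrite br0l.
    by case: X0; exists t.
  by rewrite br0l !linear0.
have id_lin : linear (@idfun N) by [].
(* Each generator carries the identity operator, whence [E x =1 id]. *)
have [[phi [phi_morph phi_i]] _] :=
  univ fox_ext (fun s => (p (i s), lendo_mk id_lin, 0)).
have fst_lin : linear (fun w => (phi w).1.1) by move=> a u v; rewrite linearP.
have snd_lin : linear (fun w => (phi w).2) by move=> a u v; rewrite linearP.
pose F : {linear f -> N} :=
  HB.pack (fun w => (phi w).1.1) (GRing.isLinear.Build K f N _ _ fst_lin).
pose D : {linear f -> N} :=
  HB.pack (fun w => (phi w).2) (GRing.isLinear.Build K f N _ _ snd_lin).
have Fp : F =1 p.
  apply: (univ N (p \o i)).2 => //.
    by move=> u v; rewrite /F /= phi_morph.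
  by move=> s; have /= := phi_i s; rewrite /F /= => ->.
exists (i t), D, (fun b => lendo_fun (phi b).1.2); split=> [n|b|w b].
- by have /= -> := phi_i t.
- exact: linear0.
- by rewrite -Fp /D /= phi_morph.
Qed.

(** * Symmetrised brackets and relative central series *)

Section Series.
Context {K : fieldType} {q : leibnizType K}.
Implicit Types (m n B : set q).

(** For such [z] the symmetrised bracket with [b] is just [br z b]. *)
Definition left_null : set q := [set z | forall b, br b z = 0].

Lemma lie_comm_left_null m n : lie_comm m n `<=` left_null.
Proof.
apply: smallest_sub => [|_ [x [y [_ _ ->]]] b]; last exact: br_sym.
split=> [b|a u v u0 v0 b]; first exact: br0r.
by rewrite brDr brZr u0 v0 scaler0 addr0.
Qed.

(** Right multiplication by [k] is a derivation of the bracket, hence of its symmetrisation. *)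
Lemma br_symM (x y k : q) : br (br x y + br y x) k =
  (br (br x k) y + br y (br x k)) + (br x (br y k) + br (br y k) x).
Proof.
rewrite brDl [br y (br x k)]br_leibniz [br x (br y k)]br_leibniz.
by rewrite !addrA [RHS](ACl (4*2*(1*5)*(3*6))) /= subrr addNr !addr0.
Qed.

Lemma lie_comm_ideal m : ideal m -> ideal (lie_comm m [set: q]).
Proof.
move=> [_ im].
have sC : subspace (lie_comm m [set: q]) := lspan_subspace _.
split=> // z k hz; split; last by rewrite (lie_comm_left_null hz); case: sC.
move: z hz; apply: smallest_sub => [|_ [x [y [mx _ ->]]] /=].
  split=> [|a u v /= hu hv] /=; first by rewrite br0l; case: sC.
  by rewrite brDl brZl; apply: sC.2.
rewrite br_symM; apply: subspaceD sC _ _; apply: sub_gen_smallest.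
  by exists (br x k), y; split=> //; case: (im x k mx).
by exists x, (br y k).
Qed.

Lemma gamma_lie_ideal n i : ideal n -> ideal (gamma_lie n i).
Proof.
by rewrite /gamma_lie => idn; elim: i.-1 => //= j; apply: lie_comm_ideal.
Qed.

Lemma gamma_lieS n i :
  gamma_lie n i.+2 = lie_comm (gamma_lie n i.+1) [set: q].
Proof. by []. Qed.

(** The preimage of [Z_lie (q / B) i] when [B] is an ideal. *)
Definition Z_rel B (i : nat) : set q :=
  iter i (fun C => [set y | forall x, C (br y x + br x y)]) B.

Lemma Z_lie_rel i : Z_lie q i = Z_rel [set 0] i.
Proof. by elim: i => //= i ->. Qed.

Lemma Z_rel_subspace B i : subspace B -> subspace (Z_rel B i).
Proof.
move=> sB; elim: i => //= i [h0 h]; split=> [x|a u v hu hv x] /=.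
  by rewrite br0l br0r addr0.
by rewrite brDl brDr brZl brZr addrACA -scalerDr; apply: h.
Qed.

(** A Galois connection: the induction moves the outermost bracket to the other side, replacing [B]
    by [Z_rel B 1]. *)
Lemma gamma_lie_sub n B i : subspace B ->
  (gamma_lie n i.+1 `<=` B) <-> (n `<=` Z_rel B i).
Proof.
elim: i B => [|i IH] B sB //.
rewrite /Z_rel iterSr -/(Z_rel _ i) -IH; last exact: (Z_rel_subspace 1 sB).
rewrite gamma_lieS; split=> [le x hx y|le].
  by apply: le; apply: sub_gen_smallest; exists x, y.
by apply: smallest_sub => // _ [x [y [/le hx _ ->]]]; apply: hx.
Qed.

End Series.

Lemma Z_rel_preim (K : fieldType) (f q : leibnizType K) (g : {linear f -> q})
    (B : set q) i :
  leibniz_morphism g -> (forall y, exists x, g x = y) ->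
  Z_rel (g @^-1` B) i = g @^-1` Z_rel B i.
Proof.
move=> gM g_surj; elim: i => //= i ->; apply/seteqP; split=> y /= hy x.
  by have [x' <-] := g_surj x; have := hy x'; rewrite linearD !gM.
by rewrite linearD !gM.
Qed.

Lemma ideal_preim (K : fieldType) (f q : leibnizType K) (g : {linear f -> q})
    (B : set q) : leibniz_morphism g -> ideal B -> ideal (g @^-1` B).
Proof.
move=> gM [sB iB]; split; first exact: preim_subspace.
by move=> x y /= Bx; rewrite !gM; apply: iB.
Qed.

Lemma ideal_image (K : fieldType) (f q : leibnizType K) (g : {linear f -> q})
    (A : set f) : leibniz_morphism g -> (forall y, exists x, g x = y) ->
  ideal A -> ideal (g @` A).
Proof.
move=> gM g_surj [[A0 sA] iA]; split; first split.
- by exists 0 => //; rewrite linear0.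
- by move=> a _ _ [u Au <-] [v Av <-]; exists (a *: u + v);
    [apply: sA | rewrite linearP].
- move=> _ y [u Au <-]; have [v <-] := g_surj y; have [uv vu] := iA u v Au.
  by split; [exists (br u v) | exists (br v u)].
Qed.

Lemma ideal_set0 (K : fieldType) (q : leibnizType K) : ideal [set 0 : q].
Proof. exact: (Z_lie_ideal q 0). Qed.

Lemma qpi_morphism (K : fieldType) (q : leibnizType K) (I : set q)
  (hI : ideal I) : leibniz_morphism (qpi hI).
Proof. exact: qpi_br. Qed.

Lemma qpi_surj (K : fieldType) (q : leibnizType K) (I : set q)
  (hI : ideal I) (y : leibniz_quot hI) : exists x, qpi hI x = y.
Proof. by exists (lrepr y); apply: qreprK. Qed.

Lemma qpi_eq0 (K : fieldType) (q : leibnizType K) (I : set q)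
  (hI : ideal I) (x : q) : qpi hI x = 0 <-> I x.
Proof.
by rewrite -[in 0](linear0 (qpi hI)) -{2}[x]subr0; apply: lpi_eq.
Qed.

Lemma leibniz_iso_ker (K : fieldType) (f p q : leibnizType K)
    (g : {linear f -> p}) (h : {linear f -> q}) :
  leibniz_morphism g -> leibniz_morphism h ->
  (forall y, exists x, g x = y) -> (forall y, exists x, h x = y) ->
  (forall x, g x = 0 <-> h x = 0) -> leibniz_iso p q.
Proof.
move=> gM hM g_surj h_surj kgh.
have eq_gh x y : g x = g y <-> h x = h y.
  split=> /eqP; rewrite -subr_eq0 -linearB => /eqP /kgh /eqP;
  by rewrite linearB subr_eq0 => /eqP.
have [s gs] := choice g_surj; have [t ht] := choice h_surj.
have hsg x : h (s (g x)) = h x by apply/eq_gh.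
have k_lin : linear (h \o s).
  by move=> a u v; rewrite /= -{1}[u]gs -{1}[v]gs -linearP hsg linearP.
pose k : {linear p -> q} :=
  HB.pack (h \o s) (GRing.isLinear.Build K p q _ _ k_lin).
exists k; split=> /=.
  by move=> u v; rewrite /= -{1}[u]gs -{1}[v]gs -gM hsg hM.
exists (g \o t) => u /=; last by rewrite hsg.
by rewrite -[RHS]gs; apply/eq_gh; rewrite ht.
Qed.

(** * Cancelling a factor in a free algebra *)

Section Cancellation.
Context {K : fieldType} {f : leibnizType K} (f_free : free_leibniz f).

(** The Fox derivative modulo [J] kills [lie_comm J [set: f]], while for [u] in [J'] it sends
    [br u x + br x u = br u x] to the class of [u]. *)
Lemma lie_comm_cancel (J J' : set f) :
  ideal J -> J `<=` left_null -> J' `<=` left_null ->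
  lie_comm J' [set: f] `<=` lie_comm J [set: f] -> J' `<=` J.
Proof.
move=> idJ J0 J'0 le u J'u; apply/(qpi_eq0 idJ).
have [x [D [E [Ex E0 DE]]]] := fox_derivative f_free (qpi_morphism idJ).
rewrite -[LHS]Ex -DE -[br u x]addr0 -(J'0 u J'u x).
have : lie_comm J [set: f] `<=` D @^-1` [set 0].
  apply: smallest_sub; first exact: preim_subspace subspace0.
  move=> _ [w [b [Jw _ ->]]] /=.
  rewrite (J0 w Jw) addr0 DE.
  exact: etrans (congr1 (E b) (iffRL (qpi_eq0 idJ w) Jw)) (E0 b).
by apply; apply: le; apply: sub_gen_smallest; exists u, x.
Qed.

(** The descent stops at index 2 because [r] and [s] themselves need not lie in [left_null]. *)
Lemma gamma_lie_cancel (r s : set f) i : ideal r ->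
  gamma_lie s i.+2 `<=` gamma_lie r i.+2 -> gamma_lie s 2 `<=` gamma_lie r 2.
Proof.
move=> idr; elim: i => // i IH le; apply: IH.
rewrite !gamma_lieS in le *.
apply: (lie_comm_cancel _ _ _ le); first exact: (gamma_lie_ideal i.+2 idr).
  exact: lie_comm_left_null.
exact: lie_comm_left_null.
Qed.

End Cancellation.

(** * Multiplier kernels and capability *)

Lemma M_lie_map_kerP (K : fieldType) (q f : leibnizType K) (c : nat)
    (rho : {linear f -> q}) (x : q) :
  (exists u : M_lie c rho, u <> 0 /\ M_lie_map c rho x u = 0) <->
  exists v, [/\ rho v = 0, gamma_lie (rho @^-1` ideal_gen x) c.+1 v &
    ~ gamma_lie (rho @^-1` [set 0]) c.+1 v].
Proof.
pose s := ker_subspace rho; pose t := preim_gen_subspace rho x.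
have pi0 r (hr : subspace r) (w : mult_num_type c hr) :
    mult_pi hr w = 0 <-> gamma_lie r c.+1 (mult_incl w).
  by rewrite -[in 0](linear0 (mult_pi hr)) /mult_pi lpi_eq subr0.
split=> [[u]|[v [v0 vs nvr]]].
  have [w <-] : exists w, mult_pi s w = u by exists (lrepr u); apply: lreprK.
  rewrite /M_lie_map mult_map_pi => -[w0 /pi0 wt]; exists (mult_incl w).
  by split=> [|//|/pi0 //]; case: (mult_inclP w).
have vn : v \in subspace_pred (mult_num_subspace c s).
  rewrite unfold_in inE; split=> //.
  exact: gamma_lie_le (@subsetT _ _) _ vs.
exists (mult_pi s (exist _ v vn)); split=> [/pi0 //|].
by rewrite /M_lie_map mult_map_pi; apply/pi0.
Qed.

Lemma lie_capable_lift (K : fieldType) (q f : leibnizType K)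
    (rho : {linear f -> q}) (c : nat) (a : f) :
  free_presentation rho -> lie_capable c.+1 q ->
  (forall b, lie_comm (rho @^-1` [set 0]) [set: f] (br a b + br b a)) ->
  rho a = 0.
Proof.
move=> [[X [i univ]] rhoM rho_surj] [h [g [gM [g' gK g'K]]]] ha.
pose Z := Z_lie_ideal h c.+1.
have [[phi [phiM phi_i]] _] := univ h (fun s => lrepr (g (rho (i s)))).
have qphi : qpi Z \o phi =1 g \o rho.
  apply: (univ _ (fun s => g (rho (i s)))).2 => [u v|u v|s|s] //=.
  - by rewrite phiM qpi_br.
  - by rewrite rhoM gM.
  - by have /= -> := phi_i s; apply: qreprK.
suff Za : Z_lie h c.+1 (phi a).
  apply: (can_inj gK); rewrite linear0; have /= <- := qphi a.
  by apply/qpi_eq0.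
have [sZ iZ] := Z_lie_ideal h c.
move=> y.
have [b rho_b] := rho_surj (g' (qpi Z y)).
have Zd : Z_lie h c.+1 (y - phi b).
  apply/(qpi_eq0 Z); rewrite linearB; have /= -> := qphi b.
  by rewrite rho_b g'K subrr.
(* Split [y] as [phi b] plus an element of [Z_lie h c.+1]. The first part contributes the image of
   an element of [lie_comm r [set: f]], [r] the kernel of [rho], and [phi] sends [r] into
   [Z_lie h c.+1]. *)
have -> : br (phi a) y + br y (phi a) =
    phi (br a b + br b a) + (br (y - phi b) (phi a) + br (phi a) (y - phi b)).
  rewrite linearD !phiM brDl brDr brNl brNr.
  by rewrite !addrA [RHS](ACl (5*3*(1*6)*(2*4))) /= !subrr !addr0.
apply: subspaceD (sZ) _ (Zd _).
have : lie_comm (rho @^-1` [set 0]) [set: f] `<=` phi @^-1` Z_lie h c.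
  apply: smallest_sub; first exact: preim_subspace.
  move=> _ [w [d [/= rho_w _ ->]]]; rewrite /= linearD !phiM.
  suff Zw : Z_lie h c.+1 (phi w) by apply: Zw.
  by apply/(qpi_eq0 Z); have /= -> := qphi w; rewrite rho_w linear0.
by apply; apply: ha.
Qed.

Theorem corollary6p9 (K : fieldType) (half : (2%:R : K) != 0)
  (q f : leibnizType K) (rho : {linear f -> q}) (hrho : free_presentation rho)
  (c : nat) (hc : (1 <= c)%N) :
  lie_capable c q <->
  forall x : q, Z_lie q c x -> x <> 0 ->
    exists u : M_lie c rho, u <> 0 /\ M_lie_map c rho x u = 0.
Proof.
have [f_free rhoM rho_surj] := hrho.
set r := rho @^-1` [set 0].
have idr : ideal r by apply: ideal_preim => //; apply: ideal_set0.
have sr : subspace r := proj1 idr.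
have Zr : Z_rel r c = rho @^-1` Z_lie q c by rewrite Z_lie_rel Z_rel_preim.
split=> [cap x Zx x0|H].
  apply/M_lie_map_kerP/not_existsP => noker.
  set s := rho @^-1` ideal_gen x.
  have s_Zr : s `<=` Z_rel r c.
    rewrite Zr; apply: preimage_subset; apply: smallest_sub => [|_ -> //].
    exact: Z_lie_ideal.
  have le_r : gamma_lie s c.+1 `<=` r by apply/gamma_lie_sub.
  have le : gamma_lie s c.+1 `<=` gamma_lie r c.+1.
    move=> v sv; apply: contrapT => nv; apply: (noker v).
    by split=> //; apply: le_r.
  have [a rho_a] := rho_surj x.
  (* Since [c] is positive, the index [c.+1] is at least 2, as cancellation requires. *)
  case: c hc cap {Zx Zr noker s_Zr le_r} le => // d _ cap le.
  apply: x0; rewrite -rho_a; apply: lie_capable_lift cap _ => // b.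
  apply: (gamma_lie_cancel f_free idr le); apply: sub_gen_smallest.
  exists a, b; split=> //; rewrite /s /= rho_a; exact: sub_gen_smallest.
have idg := gamma_lie_ideal c.+1 idr.
(* [A] is the kernel of [f] onto [h / Z_c(h)] for [h = f / gamma_{c+1}(f, r)]; it remains to show
   [A = r]. *)
pose A := Z_rel (gamma_lie r c.+1) c.
have AE : A = qpi idg @^-1` Z_lie _ c.
  rewrite Z_lie_rel -Z_rel_preim; [|exact: qpi_morphism|exact: qpi_surj].
  by congr Z_rel; apply/seteqP; split=> v /(qpi_eq0 idg).
have idA : ideal A.
  by rewrite AE; apply: ideal_preim (Z_lie_ideal _ _); apply: qpi_morphism.
have rA : r `<=` A by apply/gamma_lie_sub => //; apply: gamma_lie_subspace.
have Ar : A `<=` r.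
  move=> a Aa; apply: contrapT => ra.
  have Zra : Z_lie q c (rho a).
    rewrite -[Z_lie q c _]/((rho @^-1` Z_lie q c) a) -Zr; move: a Aa {ra}.
    have gA : gamma_lie A c.+1 `<=` gamma_lie r c.+1.
      by apply/gamma_lie_sub => //; apply: proj1 idg.
    by apply/gamma_lie_sub => // v /gA /(gamma_lie_sub_num idr) [].
  have /M_lie_map_kerP [v [_ sv []]] := H _ Zra ra.
  move: v sv; apply/gamma_lie_sub; first exact: proj1 idg.
  move=> y /(_ _ (conj (ideal_image rhoM rho_surj idA) _)) [|y' Ay' rho_y'].
    by move=> _ ->; exists a.
  rewrite -[y](subrK y'); apply: subspaceD (proj1 idA) _ Ay'.
  by apply: rA; rewrite /r /= linearB rho_y' subrr.
exists (leibniz_quot idg).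
apply: (leibniz_iso_ker (g := rho) (h := qpi (Z_lie_ideal _ c) \o qpi idg)) => //.
- by move=> u v /=; rewrite !qpi_br.
- move=> y; have [y' <-] := qpi_surj y; have [x <-] := qpi_surj y'.
  by exists x.
move=> y /=; rewrite qpi_eq0 -[Z_lie _ _ _]/((qpi idg @^-1` Z_lie _ c) y) -AE.
by split=> [/rA|/Ar].
Qed.
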